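(* Let $\nu>-1$ be real. Denote by $0<j_1^\nu<j_2^\nu<\cdots$ the positive zeros of $J_\nu(\cdot;q^2)$ and by $0<j_1^{\nu+1}<j_2^{\nu+1}<\cdots$ those of $J_{\nu+1}(\cdot;q^2)$. Then they interlace: $$0<j_1^\nu<j_1^{\nu+1}<j_2^\nu<j_2^{\nu+1}<j_3^\nu<j_3^{\nu+1}<\cdots.$$
   Context: Fix $0<q<1$. For $a\in\mathbb C$ put $(a;q)_0=1$, $(a;q)_k=\prod_{i=0}^{k-1}(1-aq^i)$, $(a;q)_\infty=\prod_{i\ge0}(1-aq^i)$. For $\nu\in\mathbb C$ and $x\in\mathbb C\setminus\{0\}$ the Hahn–Exton $q$-Bessel function is $$J_\nu(x;q^2)=\frac{x^\nu}{(q^2;q^2)_\infty}\sum_{k=0}^\infty\frac{(-1)^kq^{k(k+1)}(q^{2\nu+2k+2};q^2)_\infty}{(q^2;q^2)_k}\,x^{2k},$$ with $x^\nu=\exp(\nu\operatorname{Log}x)$ (principal branch). For $\nu>-1$ the positive zeros of $J_\nu(\cdot;q^2)$ form an infinite increasing sequence. *)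

(* Defs.v *)
From Stdlib Require Import Reals.
From Coquelicot Require Import Coquelicot.
Open Scope R_scope.

Fixpoint qpoch (a q : R) (k : nat) : R :=
  match k with
  | O => 1
  | S k' => qpoch a q k' * (1 - a * q ^ k')
  end.

Definition qpoch_inf (a q : R) : R := real (Lim_seq (fun k => qpoch a q k)).

(* Hahn–Exton q-Bessel function J_nu(x;q^2), restricted to real nu and real x > 0,
   where the principal branch x^nu = exp(nu ln x) is Rpower x nu, and
   q^{2nu+2k+2} = Rpower q (2nu+2k+2). *)
Definition HEJ (q nu x : R) : R :=
  Rpower x nu / qpoch_inf (q ^ 2) (q ^ 2) *
  Series (fun k : nat =>
    (-1) ^ k * q ^ (k * (k + 1)) *
    qpoch_inf (Rpower q (2 * nu + 2 * INR k + 2)) (q ^ 2) /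
    qpoch (q ^ 2) (q ^ 2) k * x ^ (2 * k)).

Definition enumerates_pos_zeros (f : R -> R) (s : nat -> R) : Prop :=
  (forall n, s n < s (S n)) /\
  (forall x, 0 < x -> (f x = 0 <-> exists n, s n = x)) /\
  (forall n, 0 < s n).

(* Main.v *)
(* With [a = q^(2 nu + 2)] and [z = x^2], the zeros of [J_nu] are those of an entire
   function [F_a(z)], and [J_{nu+1}] corresponds to [F_{a q^2}].  The two first-order
   [q^2]-difference relations between [F_a] and [F_{a q^2}] imply that
   [W = F_a F_{aq^2}' - F_a' F_{aq^2}] satisfies
   [W(z) = a q^2 (W(q^2 z) + F_{aq^2}(q^2 z)^2)], so [W > 0] on the real line.  Hence all
   real zeros are simple, the quotients [F_a / F_{aq^2}] and [- F_{aq^2} / F_a] are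
   strictly decreasing between poles, and the zeros interlace.  Eliminating [F_{aq^2}]
   gives a three-term relation for [F_a] at [z], [q^2 z], [q^4 z] whose coefficients are
   all positive for large [z], which forces arbitrarily large zeros. *)
Require Import Defs.
From Stdlib Require Import Reals Lra Lia.
From Coquelicot Require Import Coquelicot.
Open Scope R_scope.

(** * Finite and infinite q-shifted factorials *)

Lemma pow_unit_interval (p : R) (k : nat) : 0 < p < 1 -> 0 < p ^ k <= 1.
Proof.
  intros Hp; split; [apply pow_lt; lra|].
  rewrite <- (pow1 k); apply pow_incr; lra.
Qed.

Lemma scaled_pow_unit_interval (a p : R) (k : nat) :
  0 < p < 1 -> 0 <= a < 1 -> 0 <= a * p ^ k < 1.
Proof. intros Hp Ha; pose proof (pow_unit_interval p k Hp); nra. Qed.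

Lemma qpoch_bounds (a p : R) (k : nat) :
  0 < p < 1 -> 0 <= a < 1 -> 0 < qpoch a p k <= 1.
Proof.
  intros Hp Ha; induction k as [|k IH]; simpl; [lra|].
  pose proof (scaled_pow_unit_interval a p k Hp Ha); nra.
Qed.

(** Weierstrass product inequality: a product of factors 1 - x_i with x_i in [0, 1) is at least 1
    minus the sum of the x_i, here a geometric sum. *)
Lemma qpoch_ge_1_minus_geom (a p : R) (k : nat) :
  0 < p < 1 -> 0 <= a < 1 -> 1 - a / (1 - p) * (1 - p ^ k) <= qpoch a p k.
Proof.
  intros Hp Ha; induction k as [|k IH]; simpl; [lra|].
  pose proof (scaled_pow_unit_interval a p k Hp Ha).
  pose proof (qpoch_bounds a p k Hp Ha).
  replace (1 - a / (1 - p) * (1 - p * p ^ k))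
    with (1 - a / (1 - p) * (1 - p ^ k) - a * p ^ k) by (field; lra).
  nra.
Qed.

Lemma qpoch_S_l (a p : R) (k : nat) :
  qpoch a p (S k) = (1 - a) * qpoch (a * p) p k.
Proof.
  induction k as [|k IH]; [simpl; ring|].
  change (qpoch a p (S (S k))) with (qpoch a p (S k) * (1 - a * p ^ S k)).
  rewrite IH; simpl; ring.
Qed.

Lemma qpoch_inf_lim (a p : R) :
  0 < p < 1 -> 0 <= a < 1 -> is_lim_seq (qpoch a p) (qpoch_inf a p).
Proof.
  intros Hp Ha; apply Lim_seq_correct', ex_finite_lim_seq_decr with 0; intros n.
  - simpl; pose proof (scaled_pow_unit_interval a p n Hp Ha).
    pose proof (qpoch_bounds a p n Hp Ha); nra.
  - apply Rlt_le, qpoch_bounds; assumption.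
Qed.

Lemma qpoch_inf_S_l (a p : R) :
  0 < p < 1 -> 0 <= a < 1 ->
  qpoch_inf a p = (1 - a) * qpoch_inf (a * p) p.
Proof.
  intros Hp Ha.
  assert (Hap : 0 <= a * p < 1) by nra.
  pose proof (is_lim_seq_scal_l _ (1 - a) _ (qpoch_inf_lim (a * p) p Hp Hap)) as H1.
  pose proof (proj1 (is_lim_seq_incr_1 _ _) (qpoch_inf_lim a p Hp Ha)) as H2.
  apply (is_lim_seq_ext _ _ _ (qpoch_S_l a p)) in H2.
  apply is_lim_seq_unique in H1, H2.
  rewrite H1 in H2; injection H2; auto.
Qed.

Lemma qpoch_inf_split (a p : R) (n : nat) :
  0 < p < 1 -> 0 <= a < 1 ->
  qpoch_inf a p = qpoch a p n * qpoch_inf (a * p ^ n) p.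
Proof.
  intros Hp Ha; induction n as [|n IH]; [simpl; rewrite Rmult_1_r; ring|].
  rewrite IH, (qpoch_inf_S_l (a * p ^ n))
    by auto using scaled_pow_unit_interval.
  replace (a * p ^ S n) with (a * p ^ n * p) by (simpl; ring).
  simpl; ring.
Qed.

(** The geometric lower bound is positive only for a base below 1 - p, so finitely many positive
    factors are split off first. *)
Lemma qpoch_inf_pos (a p : R) :
  0 < p < 1 -> 0 <= a < 1 -> 0 < qpoch_inf a p.
Proof.
  intros Hp Ha.
  destruct (pow_lt_1_zero p) with (y := 1 - p) as [N HN];
    [rewrite Rabs_pos_eq; lra | lra |].
  specialize (HN N (Nat.le_refl N)).
  pose proof (pow_unit_interval p N Hp).
  rewrite Rabs_pos_eq in HN by lra.
  rewrite (qpoch_inf_split a p N Hp Ha).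
  apply Rmult_lt_0_compat; [apply qpoch_bounds; assumption|].
  pose proof (scaled_pow_unit_interval a p N Hp Ha) as HaN.
  set (b := a * p ^ N) in *.
  (* [N] was chosen with p^N < 1 - p, and a < 1, so b < 1 - p. *)
  assert (Hb : 0 < 1 - b / (1 - p)).
  { apply Rlt_0_minus, (Rmult_lt_reg_r (1 - p)); [lra|].
    unfold Rdiv; rewrite Rmult_assoc, Rinv_l by lra; unfold b; nra. }
  apply Rlt_le_trans with (1 := Hb).
  refine (is_lim_seq_le (fun _ => 1 - b / (1 - p)) _ _ _ _
            (is_lim_seq_const _) (qpoch_inf_lim b p Hp HaN)).
  intros n; apply Rle_trans with (2 := qpoch_ge_1_minus_geom b p n Hp HaN).
  pose proof (pow_unit_interval p n Hp).
  assert (0 <= b / (1 - p)) by (apply Rdiv_le_0_compat; lra).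
  nra.
Qed.

(** * The entire function F_a and its coefficients *)

(** Coefficient of z^k with z = x^2 and a = q^(2 nu + 2); the prefactor x^nu / (q^2;q^2)_inf is left
    out. *)
Definition he_coef (q a : R) (k : nat) : R :=
  (-1) ^ k * q ^ (k * (k + 1)) * qpoch_inf (a * (q ^ 2) ^ k) (q ^ 2)
  / qpoch (q ^ 2) (q ^ 2) k.

Definition he_series (q a : R) : R -> R := PSeries (he_coef q a).

Definition he_series_deriv (q a : R) : R -> R := PSeries (PS_derive (he_coef q a)).

Lemma sqr_unit_interval (q : R) : 0 < q < 1 -> 0 < q ^ 2 < 1.
Proof. intros; simpl; nra. Qed.

Lemma he_coef_neq_0 (q a : R) (k : nat) :
  0 < q < 1 -> 0 <= a < 1 -> he_coef q a k <> 0.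
Proof.
  intros Hq Ha; pose proof (sqr_unit_interval q Hq) as Hp; unfold he_coef.
  apply Rmult_integral_contrapositive_currified.
  - repeat apply Rmult_integral_contrapositive_currified.
    + apply pow_nonzero; lra.
    + apply pow_nonzero; lra.
    + apply Rgt_not_eq, qpoch_inf_pos; auto using scaled_pow_unit_interval.
  - apply Rinv_neq_0_compat, Rgt_not_eq, qpoch_bounds; lra.
Qed.

(** Both sides carry the same infinite product, since (a q^2) q^(2k) = a q^(2(k+1)), and k(k+1)
    grows by 2(k+1). *)
Lemma he_coef_step (q a : R) (k : nat) :
  0 < q < 1 -> 0 <= a < 1 ->
  he_coef q a (S k) * (1 - (q ^ 2) ^ S k)
  = - (q ^ 2) ^ S k * he_coef q (a * q ^ 2) k.
Proof.
  intros Hq Ha; pose proof (sqr_unit_interval q Hq) as Hp; unfold he_coef.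
  replace (a * q ^ 2 * (q ^ 2) ^ k) with (a * (q ^ 2) ^ S k) by (simpl; ring).
  assert (Hd : qpoch (q ^ 2) (q ^ 2) k <> 0)
    by (apply Rgt_not_eq, qpoch_bounds; lra).
  assert (H1 : 1 - (q ^ 2) ^ S k <> 0).
  { pose proof (scaled_pow_unit_interval (q ^ 2) (q ^ 2) k Hp ltac:(lra)).
    change ((q ^ 2) ^ S k) with (q ^ 2 * (q ^ 2) ^ k); lra. }
  replace (q ^ (S k * (S k + 1))) with (q ^ (k * (k + 1)) * (q ^ 2) ^ S k).
  2:{ rewrite <- pow_mult, <- pow_add; f_equal; lia. }
  change (qpoch (q ^ 2) (q ^ 2) (S k))
    with (qpoch (q ^ 2) (q ^ 2) k * (1 - (q ^ 2) ^ S k)).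
  change ((-1) ^ S k) with (-1 * (-1) ^ k).
  field; split; assumption.
Qed.

Lemma he_coef_base_shift (q a : R) (k : nat) :
  0 < q < 1 -> 0 <= a < 1 ->
  he_coef q a k = (1 - a * (q ^ 2) ^ k) * he_coef q (a * q ^ 2) k.
Proof.
  intros Hq Ha; pose proof (sqr_unit_interval q Hq) as Hp; unfold he_coef.
  rewrite (qpoch_inf_S_l (a * (q ^ 2) ^ k))
    by auto using scaled_pow_unit_interval.
  replace (a * (q ^ 2) ^ k * q ^ 2) with (a * q ^ 2 * (q ^ 2) ^ k) by ring.
  field; apply Rgt_not_eq, qpoch_bounds; lra.
Qed.

(** Ratio test: with p = q^2, the two coefficient relations give the quotient -p^(k+1) / ((1 - a
    p^k)(1 - p^(k+1))), which tends to 0. *)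
Lemma CV_radius_he_coef (q a : R) :
  0 < q < 1 -> 0 <= a < 1 -> CV_radius (he_coef q a) = p_infty.
Proof.
  intros Hq Ha; pose proof (sqr_unit_interval q Hq) as Hp.
  apply CV_radius_infinite_DAlembert; [auto using he_coef_neq_0|].
  (* Both denominator factors are smallest at k = 0. *)
  set (C := / ((1 - a) * (1 - q ^ 2))).
  apply is_lim_seq_le_le with (fun _ => 0) (fun n => C * (q ^ 2) ^ S n).
  - intros n; split; [apply Rabs_pos|].
    pose proof (scaled_pow_unit_interval a _ n Hp Ha) as Han.
    pose proof (pow_unit_interval _ n Hp) as Hn.
    pose proof (he_coef_step q a n Hq Ha) as H1.
    pose proof (he_coef_base_shift q a n Hq Ha) as H2.
    assert (Hap : 0 <= a * q ^ 2 < 1) by nra.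
    pose proof (he_coef_neq_0 q _ n Hq Hap) as H3.
    assert (Hs : (q ^ 2) ^ S n = q ^ 2 * (q ^ 2) ^ n) by reflexivity.
    replace (he_coef q a (S n) / he_coef q a n)
      with (- ((q ^ 2) ^ S n / ((1 - a * (q ^ 2) ^ n) * (1 - (q ^ 2) ^ S n)))).
    2:{ rewrite H2.
        replace (he_coef q a (S n))
          with (- (q ^ 2) ^ S n * he_coef q (a * q ^ 2) n / (1 - (q ^ 2) ^ S n)).
        - field; repeat split; try assumption; try lra; rewrite Hs; nra.
        - rewrite <- H1; field; rewrite Hs; nra. }
    rewrite Rabs_Ropp, Rabs_pos_eq.
    + rewrite (Rmult_comm C); unfold Rdiv, C; apply Rmult_le_compat_l.
      * rewrite Hs; nra.
      * apply Rinv_le_contravar; [nra|].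
        apply Rmult_le_compat; rewrite ?Hs; nra.
    + apply Rdiv_le_0_compat; rewrite Hs; [nra|].
      apply Rmult_lt_0_compat; nra.
  - apply is_lim_seq_const.
  - replace (Finite 0) with (Rbar_mult C 0) by (simpl; f_equal; ring).
    apply is_lim_seq_scal_l.
    apply (is_lim_seq_incr_1 (fun n => (q ^ 2) ^ n)), is_lim_seq_geom.
    rewrite Rabs_pos_eq; lra.
Qed.

Lemma ex_pseries_he_coef (q a z : R) :
  0 < q < 1 -> 0 <= a < 1 -> ex_pseries (he_coef q a) z.
Proof. intros Hq Ha; apply CV_radius_inside; rewrite CV_radius_he_coef; easy. Qed.

Lemma is_derive_he_series (q a z : R) :
  0 < q < 1 -> 0 <= a < 1 ->
  is_derive (he_series q a) z (he_series_deriv q a z).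
Proof. intros Hq Ha; apply is_derive_PSeries; rewrite CV_radius_he_coef; easy. Qed.

Lemma continuous_he_series (q a z : R) :
  0 < q < 1 -> 0 <= a < 1 -> continuity_pt (he_series q a) z.
Proof. intros Hq Ha; apply PSeries_continuity; rewrite CV_radius_he_coef; easy. Qed.

Lemma continuous_he_series_deriv (q a z : R) :
  0 < q < 1 -> 0 <= a < 1 -> continuity_pt (he_series_deriv q a) z.
Proof.
  intros Hq Ha; apply PSeries_continuity.
  rewrite CV_radius_derive, CV_radius_he_coef; easy.
Qed.

Lemma he_series_0_pos (q a : R) :
  0 < q < 1 -> 0 <= a < 1 -> 0 < he_series q a 0.
Proof.
  intros Hq Ha; pose proof (sqr_unit_interval q Hq) as Hp.
  unfold he_series; rewrite PSeries_0.
  replace (he_coef q a 0) with (qpoch_inf (a * (q ^ 2) ^ 0) (q ^ 2))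
    by (unfold he_coef; cbn [qpoch]; simpl; field).
  apply qpoch_inf_pos; auto using scaled_pow_unit_interval.
Qed.

(** * First-order difference relations for F_a and its derivative *)

Lemma PSeries_scaled_arg (c : nat -> R) (r z : R) :
  PSeries c (r * z) = PSeries (fun k => c k * r ^ k) z.
Proof. apply Series_ext; intros k; rewrite Rpow_mult_distr; ring. Qed.

Lemma ex_pseries_scaled_arg (c : nat -> R) (r z : R) :
  ex_pseries c (r * z) -> ex_pseries (fun k => c k * r ^ k) z.
Proof.
  rewrite !ex_pseries_R; apply ex_series_ext.
  intros k; rewrite Rpow_mult_distr, Rmult_assoc; reflexivity.
Qed.

(** [he_coef_base_shift] summed: a factor q^(2k) in the coefficients rescales the argument by
    q^2. *)
Lemma he_series_base_shift (q a z : R) :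
  0 < q < 1 -> 0 <= a < 1 ->
  he_series q a z
  = he_series q (a * q ^ 2) z - a * he_series q (a * q ^ 2) (q ^ 2 * z).
Proof.
  intros Hq Ha; pose proof (sqr_unit_interval q Hq) as Hp.
  assert (Hap : 0 <= a * q ^ 2 < 1) by nra.
  unfold he_series; rewrite PSeries_scaled_arg, <- PSeries_scal, <- PSeries_minus.
  - apply PSeries_ext; intros k; rewrite he_coef_base_shift by assumption.
    unfold PS_minus, PS_plus, PS_opp, PS_scal; simpl.
    unfold plus, opp, scal; simpl; unfold mult; simpl; ring.
  - auto using ex_pseries_he_coef.
  - apply ex_pseries_scal; [apply Rmult_comm|].
    apply ex_pseries_scaled_arg; auto using ex_pseries_he_coef.
Qed.

(** [he_coef_step] summed: in F_a(q^2 z) - F_a(z) the constant terms cancel, and the index shift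
    produces the factor q^2 z. *)
Lemma he_series_arg_shift (q a z : R) :
  0 < q < 1 -> 0 <= a < 1 ->
  he_series q a (q ^ 2 * z)
  = he_series q a z + q ^ 2 * z * he_series q (a * q ^ 2) (q ^ 2 * z).
Proof.
  intros Hq Ha; pose proof (sqr_unit_interval q Hq) as Hp.
  assert (Hap : 0 <= a * q ^ 2 < 1) by nra.
  unfold he_series; rewrite !PSeries_scaled_arg.
  rewrite (Rmult_comm (q ^ 2) z), Rmult_assoc, <- PSeries_scal, <- PSeries_incr_1.
  rewrite <- PSeries_plus.
  - apply PSeries_ext; intros [|k]; unfold PS_plus, PS_incr_1, PS_scal, plus, zero; simpl.
    + ring.
    + unfold scal; simpl; unfold mult; simpl.
      pose proof (he_coef_step q a k Hq Ha) as H; simpl in H; lra.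
  - auto using ex_pseries_he_coef.
  - apply ex_pseries_incr_1, ex_pseries_scal; [apply Rmult_comm|].
    apply ex_pseries_scaled_arg; auto using ex_pseries_he_coef.
Qed.

Lemma is_derive_he_series_scaled (q a z : R) :
  0 < q < 1 -> 0 <= a < 1 ->
  is_derive (fun t => he_series q a (q ^ 2 * t)) z
    (q ^ 2 * he_series_deriv q a (q ^ 2 * z)).
Proof.
  intros Hq Ha; apply (is_derive_comp (he_series q a)).
  - auto using is_derive_he_series.
  - auto_derive; [easy|ring].
Qed.

(** Both sides are the derivative at z of the same function, by [he_series_base_shift]. *)
Lemma he_series_deriv_base_shift (q a z : R) :
  0 < q < 1 -> 0 <= a < 1 ->
  he_series_deriv q a z
  = he_series_deriv q (a * q ^ 2) z
    - a * (q ^ 2 * he_series_deriv q (a * q ^ 2) (q ^ 2 * z)).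
Proof.
  intros Hq Ha; pose proof (sqr_unit_interval q Hq) as Hp.
  assert (Hap : 0 <= a * q ^ 2 < 1) by nra.
  rewrite <- (is_derive_unique _ _ _ (is_derive_he_series q a z Hq Ha)).
  apply is_derive_unique.
  apply (is_derive_ext (fun t => he_series q (a * q ^ 2) t
           - a * he_series q (a * q ^ 2) (q ^ 2 * t))).
  - intros t; symmetry; auto using he_series_base_shift.
  - apply @is_derive_minus; [auto using is_derive_he_series|].
    apply is_derive_scal; auto using is_derive_he_series_scaled.
Qed.

Lemma he_series_deriv_arg_shift (q a z : R) :
  0 < q < 1 -> 0 <= a < 1 ->
  q ^ 2 * he_series_deriv q a (q ^ 2 * z)
  = he_series_deriv q a z
    + (q ^ 2 * he_series q (a * q ^ 2) (q ^ 2 * z)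
       + q ^ 2 * z * (q ^ 2 * he_series_deriv q (a * q ^ 2) (q ^ 2 * z))).
Proof.
  intros Hq Ha; pose proof (sqr_unit_interval q Hq) as Hp.
  assert (Hap : 0 <= a * q ^ 2 < 1) by nra.
  rewrite <- (is_derive_unique _ _ _ (is_derive_he_series_scaled q a z Hq Ha)).
  apply is_derive_unique.
  apply (is_derive_ext (fun t => he_series q a t
           + q ^ 2 * t * he_series q (a * q ^ 2) (q ^ 2 * t))).
  - intros t; symmetry; auto using he_series_arg_shift.
  - apply @is_derive_plus; [auto using is_derive_he_series|].
    apply (is_derive_mult (fun t => q ^ 2 * t)
             (fun t => he_series q (a * q ^ 2) (q ^ 2 * t)) z (q ^ 2)
             (q ^ 2 * he_series_deriv q (a * q ^ 2) (q ^ 2 * z))).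
    + auto_derive; [easy|ring].
    + auto using is_derive_he_series_scaled.
    + exact Rmult_comm.
Qed.

(** * Positivity of the Wronskian *)

Definition he_wronskian (q a z : R) : R :=
  he_series q a z * he_series_deriv q (a * q ^ 2) z
  - he_series_deriv q a z * he_series q (a * q ^ 2) z.

(** Write p = q^2, F = F_a, G = F_{ap}. The base shift reduces W(z) to a (p G(z) G'(pz) - G'(z)
    G(pz)). The argument shift reduces p (W(pz) + G(pz)^2) to the same bracket, the terms with an
    explicit z cancelling. *)
Lemma he_wronskian_rec (q a z : R) :
  0 < q < 1 -> 0 < a < 1 ->
  he_wronskian q a z
  = a * q ^ 2 * (he_wronskian q a (q ^ 2 * z)
                 + he_series q (a * q ^ 2) (q ^ 2 * z) ^ 2).
Proof.
  intros Hq Ha; pose proof (sqr_unit_interval q Hq) as Hp.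
  unfold he_wronskian.
  pose proof (he_series_base_shift q a z Hq ltac:(lra)) as H1.
  pose proof (he_series_arg_shift q a z Hq ltac:(lra)) as H2.
  pose proof (he_series_deriv_base_shift q a z Hq ltac:(lra)) as H3.
  pose proof (he_series_deriv_arg_shift q a z Hq ltac:(lra)) as H4.
  set (p := q ^ 2) in *; set (G := he_series q (a * p)) in *.
  set (G' := he_series_deriv q (a * p)) in *.
  set (F := he_series q a) in *; set (F' := he_series_deriv q a) in *.
  replace (F' (p * z)) with ((F' z + (p * G (p * z) + p * z * (p * G' (p * z)))) / p)
    by (rewrite <- H4; field; lra).
  rewrite H2, H3, H1; field; lra.
Qed.

(** Each application of the recursion discards a nonnegative square. *)
Lemma he_wronskian_ge_iter (q a z : R) (n : nat) :
  0 < q < 1 -> 0 < a < 1 ->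
  (a * q ^ 2) ^ n * he_wronskian q a ((q ^ 2) ^ n * z) <= he_wronskian q a z.
Proof.
  intros Hq Ha; pose proof (sqr_unit_interval q Hq) as Hp.
  induction n as [|n IH]; [simpl; rewrite !Rmult_1_l; apply Rle_refl|].
  apply Rle_trans with (2 := IH).
  rewrite (he_wronskian_rec q a ((q ^ 2) ^ n * z)) by assumption.
  replace ((q ^ 2) ^ S n * z) with (q ^ 2 * ((q ^ 2) ^ n * z)) by (simpl; ring).
  change ((a * q ^ 2) ^ S n) with (a * q ^ 2 * (a * q ^ 2) ^ n).
  assert (Hap : 0 < a * q ^ 2) by nra.
  pose proof (Rmult_lt_0_compat _ _ Hap (pow_lt _ n Hap)) as Hpos.
  pose proof (pow2_ge_0 (he_series q (a * q ^ 2) (q ^ 2 * ((q ^ 2) ^ n * z)))) as HG.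
  pose proof (Rmult_le_pos _ _ (Rlt_le _ _ Hpos) HG); lra.
Qed.

(* Iterating the recursion moves the argument to [0], where it reads
   [W(0) (1 - a q^2) = a q^2 F_{aq^2}(0)^2 > 0]. *)
Lemma he_wronskian_pos (q a z : R) :
  0 < q < 1 -> 0 < a < 1 -> 0 < he_wronskian q a z.
Proof.
  intros Hq Ha; pose proof (sqr_unit_interval q Hq) as Hp.
  assert (Hap : 0 < a * q ^ 2 < 1) by nra.
  assert (H0 : 0 < he_wronskian q a 0).
  { pose proof (he_wronskian_rec q a 0 Hq Ha) as H; rewrite Rmult_0_r in H.
    pose proof (pow_lt _ 2 (he_series_0_pos q (a * q ^ 2) Hq ltac:(lra))) as HG.
    apply (Rmult_lt_reg_l (1 - a * q ^ 2)); [lra|].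
    pose proof (Rmult_lt_0_compat _ _ (proj1 Hap) HG); lra. }
  assert (Hlim : is_lim_seq (fun n => he_wronskian q a ((q ^ 2) ^ n * z))
                   (he_wronskian q a 0)).
  { apply is_lim_seq_continuous.
    - apply continuity_pt_minus; apply continuity_pt_mult;
        (apply continuous_he_series || apply continuous_he_series_deriv); lra.
    - replace (Finite 0) with (Rbar_mult 0 z) by (simpl; f_equal; ring).
      apply is_lim_seq_scal_r, is_lim_seq_geom; rewrite Rabs_pos_eq; lra. }
  apply is_lim_seq_spec in Hlim.
  (* With tolerance W(0), closeness to W(0) already means positivity. *)
  destruct (Hlim (mkposreal _ H0)) as [N HN]; specialize (HN N (Nat.le_refl N)).
  simpl in HN; apply Rabs_def2 in HN.
  apply Rlt_le_trans with (2 := he_wronskian_ge_iter q a z N Hq Ha).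
  apply Rmult_lt_0_compat; [apply pow_lt; lra|].
  simpl; lra.
Qed.

(** * Enumeration of isolated, unbounded zeros *)

(** The punctured neighbourhood allows t to be a zero or not, so accumulation points are excluded
    too; t = 0 is included because the enumeration starts there. *)
Definition isolated_zeros (f : R -> R) : Prop :=
  forall t, 0 <= t ->
  exists e, 0 < e /\ forall x, 0 < Rabs (x - t) < e -> f x <> 0.

Definition unbounded_zeros (f : R -> R) : Prop :=
  forall M, exists x, M < x /\ f x = 0.

(** Take the supremum m of all y with no zero in (t, y). Isolation at t gives m > t; if f(m) were
    nonzero, isolation at m would push the supremum further. The sigma type lets the choice be
    iterated as a function. *)
Lemma next_zero (f : R -> R) (t : R) :
  isolated_zeros f -> unbounded_zeros f -> 0 <= t ->
  {y : R | t < y /\ f y = 0 /\ forall x, t < x < y -> f x <> 0}.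
Proof.
  intros Hiso Hunb Ht.
  set (E := fun y => t <= y /\ forall x, t < x < y -> f x <> 0).
  destruct (completeness E) as [m [Hub Hlub]].
  - destruct (Hunb t) as [z [Hz Hfz]]; exists z; intros y [_ Hy].
    destruct (Rle_or_lt y z) as [|Hzy]; [assumption|].
    exfalso; apply (Hy z); [lra|assumption].
  - exists t; split; [lra|]; intros x Hx; lra.
  - assert (Hno : forall x, t < x < m -> f x <> 0).
    { intros x Hx Hfx; apply (Rlt_not_le m x); [lra|].
      apply Hlub; intros y [_ Hy]; destruct (Rle_or_lt y x) as [|Hxy]; [assumption|].
      exfalso; apply (Hy x); [lra|assumption]. }
    assert (Htm : t < m).
    { destruct (Hiso t Ht) as [e [He Hiso_t]].
      apply Rlt_le_trans with (t + e); [lra|]; apply Hub; split; [lra|].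
      intros x Hx; apply Hiso_t; rewrite Rabs_pos_eq; lra. }
    exists m; split; [exact Htm|]; split; [|exact Hno].
    destruct (Req_dec (f m) 0) as [|Hfm]; [assumption|exfalso].
    destruct (Hiso m ltac:(lra)) as [e [He Hiso_m]].
    apply (Rlt_not_le (m + e) m); [lra|]; apply Hub; split; [lra|].
    intros x Hx; destruct (Rtotal_order x m) as [Hxm|[->|Hxm]].
    + apply Hno; lra.
    + exact Hfm.
    + apply Hiso_m; rewrite Rabs_pos_eq; lra.
Qed.

Lemma isolated_zeros_enumeration (f : R -> R) :
  isolated_zeros f -> unbounded_zeros f ->
  exists s : nat -> R, enumerates_pos_zeros f s.
Proof.
  intros Hiso Hunb.
  pose (next := fun t : {t : R | 0 <= t} =>
    let (y, Hy) := next_zero f (proj1_sig t) Hiso Hunb (proj2_sig t) in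
    exist (fun t => 0 <= t) y
      (Rle_trans _ _ _ (proj2_sig t) (Rlt_le _ _ (proj1 Hy)))).
  assert (Hnext : forall t, let y := proj1_sig (next t) in
    proj1_sig t < y /\ f y = 0 /\ forall x, proj1_sig t < x < y -> f x <> 0).
  { intros t; unfold next; destruct next_zero as [y Hy]; exact Hy. }
  (* [S n] iterations, so that index 0 is the first positive zero and not the starting point 0. *)
  pose (r := fun n => Nat.iter (S n) next (exist _ 0 (Rle_refl 0))).
  pose (s := fun n => proj1_sig (r n)).
  assert (Hs0 : 0 < s O /\ forall x, 0 < x < s O -> f x <> 0).
  { destruct (Hnext (exist _ 0 (Rle_refl 0))) as [H1 [_ H3]]; split; assumption. }
  assert (HsS : forall n, s n < s (S n) /\ forall x, s n < x < s (S n) -> f x <> 0).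
  { intros n; destruct (Hnext (r n)) as [H1 [_ H3]]; split; assumption. }
  assert (Hsz : forall n, f (s n) = 0).
  { intros [|n]; apply Hnext. }
  assert (Hpos : forall n, 0 < s n).
  { induction n as [|n IH]; [apply Hs0|]; pose proof (proj1 (HsS n)); lra. }
  assert (Hbelow : forall x, 0 < x -> f x = 0 -> forall n, x <= s n -> exists k, s k = x).
  { intros x Hx Hfx; induction n as [|n IH]; intros Hxn.
    - destruct Hxn as [Hxn| ->]; [|eauto].
      exfalso; apply (proj2 Hs0 x); [lra|assumption].
    - destruct (Rle_or_lt x (s n)) as [Hle|Hlt]; [auto|].
      destruct Hxn as [Hxn| ->]; [|eauto].
      exfalso; apply (proj2 (HsS n) x); [lra|assumption]. }
  (* A bounded sequence of zeros would accumulate at its supremum [L], against isolation there. *)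
  assert (Hunbs : forall x, exists n, x <= s n).
  { intros x; destruct (Classical_Prop.classic (exists n, x <= s n)) as [|Hn];
      [assumption|exfalso].
    assert (Hb : forall n, s n <= x).
    { intros n; destruct (Rle_or_lt (s n) x); [assumption|].
      exfalso; apply Hn; exists n; lra. }
    destruct (completeness (fun y => exists n, y = s n)) as [L [HLub HL]].
    - exists x; intros y [n ->]; apply Hb.
    - exists (s O), O; reflexivity.
    - assert (HsL : forall n, s n < L).
      { intros n; apply Rlt_le_trans with (1 := proj1 (HsS n)); apply HLub; eauto. }
      destruct (Hiso L) as [e [He HisoL]].
      { pose proof (HsL O); pose proof (Hpos O); lra. }
      apply (Rlt_not_le L (L - e)); [lra|]; apply HL; intros y [n ->].
      destruct (Rle_or_lt (s n) (L - e)) as [|Hlt]; [assumption|].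
      exfalso; apply (HisoL (s n)); [|apply Hsz].
      pose proof (HsL n); rewrite Rabs_left; lra. }
  exists s; split; [intros n; apply HsS|split; [|exact Hpos]].
  intros x Hx; split.
  - intros Hfx; destruct (Hunbs x) as [n Hn]; eauto.
  - intros [n <-]; apply Hsz.
Qed.

Lemma isolated_zeros_of_deriv (f f' : R -> R) :
  (forall t, is_derive f t (f' t)) ->
  (forall t, f t = 0 -> f' t <> 0) ->
  isolated_zeros f.
Proof.
  intros Hd Hsimple t _.
  destruct (Req_dec (f t) 0) as [Hft|Hft].
  - pose proof (Rabs_pos_lt _ (Hsimple t Hft)) as Hpos.
    pose proof (proj1 (is_derive_Reals _ _ _) (Hd t)) as Hdt.
    (* Tolerance |f'(t)|: a second zero x would give difference quotient 0, at distance exactly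
       |f'(t)| from f'(t). *)
    destruct (Hdt _ Hpos) as [d Hdelta].
    exists d; split; [apply cond_pos|]; intros x Hx Hfx.
    assert (Hxt : x - t <> 0) by (intros H; rewrite H, Rabs_R0 in Hx; lra).
    specialize (Hdelta (x - t) Hxt (proj2 Hx)).
    replace (t + (x - t)) with x in Hdelta by ring.
    rewrite Hfx, Hft in Hdelta.
    replace ((0 - 0) / (x - t) - f' t) with (- f' t) in Hdelta by (field; exact Hxt).
    rewrite Rabs_Ropp in Hdelta; lra.
  - assert (Hc : continuity_pt f t).
    { apply continuity_pt_filterlim, (ex_derive_continuous f); eexists; apply Hd. }
    destruct (Hc _ (Rabs_pos_lt _ Hft)) as [d [Hdpos Hcd]].
    exists d; split; [exact Hdpos|]; intros x Hx Hfx.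
    assert (Hxt : t <> x) by (intros <-; rewrite Rminus_diag, Rabs_R0 in Hx; lra).
    specialize (Hcd x (conj (conj I Hxt) (proj2 Hx))).
    simpl in Hcd; unfold Rdist in Hcd.
    rewrite Hfx, Rminus_0_l, Rabs_Ropp in Hcd; lra.
Qed.

(** * Interlacing from a positive Wronskian *)

Definition zeros_between (f g : R -> R) : Prop :=
  forall x y, 0 < x < y -> f x = 0 -> f y = 0 -> exists z, x < z < y /\ g z = 0.

(** The derivative of f/g is minus the Wronskian over g^2; apply the mean value theorem. *)
Lemma strict_quotient_decrease (f g f' g' : R -> R) (x y : R) :
  (forall t, is_derive f t (f' t)) -> (forall t, is_derive g t (g' t)) ->
  (forall t, 0 < f t * g' t - f' t * g t) ->
  x < y -> (forall t, x <= t <= y -> g t <> 0) ->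
  f y / g y < f x / g x.
Proof.
  intros Hf Hg HW Hxy Hnz.
  assert (Hd : forall t, x <= t <= y ->
    is_derive (fun t => f t / g t) t ((f' t * g t - f t * g' t) / g t ^ 2)).
  { intros t Ht; apply is_derive_div; auto. }
  destruct (MVT_gen (fun t => f t / g t) x y
              (fun t => (f' t * g t - f t * g' t) / g t ^ 2)) as [c [Hc Hmvt]].
  - rewrite Rmin_left, Rmax_right by lra; intros t Ht; apply Hd; lra.
  - rewrite Rmin_left, Rmax_right by lra; intros t Ht.
    apply continuity_pt_filterlim, (ex_derive_continuous (fun t => f t / g t)).
    eexists; apply Hd, Ht.
  - rewrite Rmin_left, Rmax_right in Hc by lra.
    assert (Hneg : 0 < (f c * g' c - f' c * g c) / g c ^ 2).
    { apply Rdiv_lt_0_compat; [apply HW|]; apply pow2_gt_0; auto. }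
    replace ((f' c * g c - f c * g' c) / g c ^ 2)
      with (- ((f c * g' c - f' c * g c) / g c ^ 2)) in Hmvt by (field; auto).
    nra.
Qed.

(** The Wronskian forbids common zeros, so without a zero of g inside, f/g is defined on all of
    [x, y] and vanishes at both ends, yet strictly decreases. *)
Lemma wronskian_zeros_between (f g f' g' : R -> R) :
  (forall t, is_derive f t (f' t)) -> (forall t, is_derive g t (g' t)) ->
  (forall t, 0 < f t * g' t - f' t * g t) ->
  zeros_between f g.
Proof.
  intros Hf Hg HW x y Hxy Hx Hy.
  apply Classical_Prop.NNPP; intros Hno.
  assert (Hnz : forall t, x <= t <= y -> g t <> 0).
  { intros t Ht Hgt; pose proof (HW t) as HWt; rewrite Hgt in HWt.
    destruct (Req_dec t x) as [->|Hx']; [rewrite Hx in HWt; lra|].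
    destruct (Req_dec t y) as [->|Hy']; [rewrite Hy in HWt; lra|].
    apply Hno; exists t; split; [lra|assumption]. }
  pose proof (strict_quotient_decrease f g f' g' x y Hf Hg HW (proj2 Hxy) Hnz) as H.
  rewrite Hx, Hy in H; unfold Rdiv in H; lra.
Qed.

Lemma is_derive_opp_pointwise (g g' : R -> R) :
  (forall t, is_derive g t (g' t)) ->
  forall t, is_derive (fun t => - g t) t (- g' t).
Proof. intros H t; apply (is_derive_opp g), H. Qed.

(** This decides which function has the first zero. The pair (-g, f) has the same Wronskian; without
    a zero of f, -g/f would decrease from a negative value at 0 to the value 0 at y. *)
Lemma wronskian_zero_below (f g f' g' : R -> R) (y : R) :
  (forall t, is_derive f t (f' t)) -> (forall t, is_derive g t (g' t)) ->
  (forall t, 0 < f t * g' t - f' t * g t) ->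
  0 < f 0 -> 0 < g 0 -> 0 < y -> g y = 0 ->
  exists x, 0 < x < y /\ f x = 0.
Proof.
  intros Hf Hg HW Hf0 Hg0 Hy Hgy.
  apply Classical_Prop.NNPP; intros Hno.
  assert (Hnz : forall t, 0 <= t <= y -> f t <> 0).
  { intros t Ht Hft; pose proof (HW t) as HWt; rewrite Hft in HWt.
    destruct (Req_dec t 0) as [->|H0']; [lra|].
    destruct (Req_dec t y) as [->|Hy']; [rewrite Hgy in HWt; lra|].
    apply Hno; exists t; split; [lra|assumption]. }
  pose proof (strict_quotient_decrease (fun t => - g t) f (fun t => - g' t) f' 0 y
    (is_derive_opp_pointwise _ _ Hg) Hf ltac:(intros t; specialize (HW t); lra) Hy Hnz) as H.
  cbv beta in H; rewrite Hgy in H; unfold Rdiv in H.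
  pose proof (Rinv_0_lt_compat _ Hf0); nra.
Qed.

Lemma enumerates_pos_zeros_lt (f : R -> R) (s : nat -> R) (m n : nat) :
  enumerates_pos_zeros f s -> s m < s n <-> (m < n)%nat.
Proof.
  intros [Hs _].
  assert (Hle : forall i d, s i <= s (i + d)%nat).
  { intros i; induction d as [|d IH]; [rewrite Nat.add_0_r; lra|].
    rewrite Nat.add_succ_r; specialize (Hs (i + d)%nat); lra. }
  split; intros H.
  - destruct (Nat.lt_ge_cases m n) as [|Hge]; [assumption|].
    specialize (Hle n (m - n)%nat); replace (n + (m - n))%nat with m in Hle by lia; lra.
  - specialize (Hle (S m) (n - S m)%nat); specialize (Hs m).
    replace (S m + (n - S m))%nat with n in Hle by lia; lra.
Qed.

(** Induction on n. A zero s_m between t_n and t_{n+1} has m > n because s_n < t_n, hence s_{n+1} <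
    t_{n+1}; a zero t_m between s_{n+1} and s_{n+2} has m > n because t_n < s_{n+1}, hence t_{n+1} <
    s_{n+2}. *)
Lemma enumerations_interlace (f g : R -> R) (s t : nat -> R) :
  enumerates_pos_zeros f s -> enumerates_pos_zeros g t ->
  zeros_between f g -> zeros_between g f ->
  (forall y, 0 < y -> g y = 0 -> exists x, 0 < x < y /\ f x = 0) ->
  forall n, s n < t n /\ t n < s (S n).
Proof.
  intros Hs Ht Hfg Hgf Hfirst.
  pose proof Hs as [Hsinc [Hsz Hspos]]; pose proof Ht as [Htinc [Htz Htpos]].
  assert (Hzs : forall n, f (s n) = 0) by (intros n; apply Hsz; eauto).
  assert (Hzt : forall n, g (t n) = 0) by (intros n; apply Htz; eauto).
  assert (Hle : forall u h m k, enumerates_pos_zeros h u -> (m <= k)%nat -> u m <= u k).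
  { intros u h m k Hu Hmk; destruct (Nat.eq_dec m k) as [->|]; [lra|].
    apply Rlt_le, (enumerates_pos_zeros_lt h u); [assumption|lia]. }
  assert (Hup : forall n, exists m, s n < t m < s (S n)).
  { intros n; destruct (Hfg (s n) (s (S n))) as [z [Hz Hgz]]; auto.
    apply Htz in Hgz as [m <-]; [eauto|]; specialize (Hspos n); lra. }
  induction n as [|n [IH1 IH2]].
  - assert (H0 : s O < t O).
    { destruct (Hfirst (t O)) as [x [Hx Hfx]]; auto.
      apply Hsz in Hfx as [m <-]; [|lra].
      pose proof (Hle s f O m Hs ltac:(lia)); lra. }
    split; [exact H0|].
    destruct (Hup O) as [m Hm]; pose proof (Hle t g O m Ht ltac:(lia)); lra.
  - assert (H1 : s (S n) < t (S n)).
    { destruct (Hgf (t n) (t (S n))) as [z [Hz Hfz]]; auto.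
      apply Hsz in Hfz as [m <-]; [|specialize (Htpos n); lra].
      assert (Hnm : (n < m)%nat) by (apply (enumerates_pos_zeros_lt f s); [assumption|lra]).
      pose proof (Hle s f (S n) m Hs Hnm); lra. }
    split; [exact H1|].
    destruct (Hup (S n)) as [m Hm].
    assert (Hnm : (n < m)%nat) by (apply (enumerates_pos_zeros_lt g t); [assumption|lra]).
    pose proof (Hle t g (S n) m Ht Hnm); lra.
Qed.

Lemma enumerates_pos_zeros_sqr (f g : R -> R) (s : nat -> R) :
  (forall x, 0 < x -> f x = 0 <-> g (x ^ 2) = 0) ->
  enumerates_pos_zeros g s -> enumerates_pos_zeros f (fun n => sqrt (s n)).
Proof.
  intros Hfg [Hinc [Hz Hpos]]; split; [|split].
  - intros n; apply sqrt_lt_1_alt; split; [apply Rlt_le, Hpos|apply Hinc].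
  - intros x Hx; rewrite (Hfg x Hx), (Hz (x ^ 2)) by (apply pow_lt; assumption).
    split; intros [n Hn]; exists n.
    + rewrite Hn; apply sqrt_pow2; lra.
    + rewrite <- Hn, pow2_sqrt; [reflexivity|]; apply Rlt_le; auto.
  - intros n; apply sqrt_lt_R0; auto.
Qed.

(** * Three-term relation and arbitrarily large zeros *)

(** With p = q^2 and G = F_{ap}, the argument shift turns F_a(z) - F_a(pz) and F_a(p^2 z) - F_a(pz)
    into multiples of G(pz) and G(p^2 z); the base shift at pz cancels both. *)
Lemma he_series_three_term (q a z : R) :
  0 < q < 1 -> 0 < a < 1 ->
  he_series q a z + (q ^ 2 * z - 1 - a / q ^ 2) * he_series q a (q ^ 2 * z)
  + a / q ^ 2 * he_series q a (q ^ 2 * (q ^ 2 * z)) = 0.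
Proof.
  intros Hq Ha; pose proof (sqr_unit_interval q Hq) as Hp.
  pose proof (he_series_base_shift q a (q ^ 2 * z) Hq ltac:(lra)) as H1.
  pose proof (he_series_arg_shift q a z Hq ltac:(lra)) as H2.
  pose proof (he_series_arg_shift q a (q ^ 2 * z) Hq ltac:(lra)) as H3.
  set (p := q ^ 2) in *; set (G := he_series q (a * p)) in *.
  rewrite H3.
  replace (he_series q a z) with (he_series q a (p * z) - p * z * G (p * z)) by lra.
  rewrite H1; field; lra.
Qed.

(* For large [z] the three-term relation has positive coefficients, so its three
   values cannot share a sign. *)
Lemma he_series_unbounded_zeros (q a : R) :
  0 < q < 1 -> 0 < a < 1 -> unbounded_zeros (he_series q a).
Proof.
  intros Hq Ha M; pose proof (sqr_unit_interval q Hq) as Hp.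
  apply Classical_Prop.NNPP; intros Hno.
  assert (Hnz : forall x, M < x -> he_series q a x <> 0) by (intros x Hx Hfx; eauto).
  (* Without zeros beyond [M], the intermediate value theorem fixes the sign there. *)
  assert (Hsign : forall x y, M < x -> M < y -> 0 < he_series q a x * he_series q a y).
  { intros x y Hx Hy.
    destruct (Rlt_or_le 0 (he_series q a x * he_series q a y)) as [|Hle];
      [assumption|exfalso].
    destruct (IVT_gen (he_series q a) x y 0) as [c [Hc Hfc]].
    - intros t; apply continuous_he_series; lra.
    - unfold Rmin, Rmax; destruct Rle_dec; nra.
    - apply (Hnz c); [|assumption].
      revert Hc; unfold Rmin; destruct Rle_dec; lra. }
  assert (Hapos : 0 < a / q ^ 2) by (apply Rdiv_lt_0_compat; lra).
  (* Chosen so that all three points, even the smallest q^4 z, exceed [M] and the middle coefficient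
     is positive; the final 1 makes this strict. *)
  set (z := (1 + a / q ^ 2 + Rabs M) / (q ^ 2 * q ^ 2) + 1).
  assert (Hz : 1 + a / q ^ 2 + Rabs M < q ^ 2 * (q ^ 2 * z)).
  { unfold z; replace (q ^ 2 * (q ^ 2 * _))
      with (1 + a / q ^ 2 + Rabs M + q ^ 2 * q ^ 2) by (field; lra); nra. }
  pose proof (Rle_abs M); pose proof (Rabs_pos M).
  assert (Hz1 : q ^ 2 * (q ^ 2 * z) < q ^ 2 * z) by nra.
  assert (Hz2 : q ^ 2 * z < z) by nra.
  pose proof (he_series_three_term q a z Hq Ha) as H3.
  pose proof (Hsign z (q ^ 2 * z) ltac:(lra) ltac:(lra)) as S1.
  pose proof (Hsign (q ^ 2 * (q ^ 2 * z)) (q ^ 2 * z) ltac:(lra) ltac:(lra)) as S2.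
  pose proof (Hsign (q ^ 2 * z) (q ^ 2 * z) ltac:(lra) ltac:(lra)) as S3.
  set (A := he_series q a z) in *; set (B := he_series q a (q ^ 2 * z)) in *.
  set (C := he_series q a (q ^ 2 * (q ^ 2 * z))) in *.
  (* Multiplying the relation by [B] leaves only products already known to be positive. *)
  assert (Hsum : A * B + (q ^ 2 * z - 1 - a / q ^ 2) * (B * B)
                 + a / q ^ 2 * (C * B) = 0).
  { transitivity ((A + (q ^ 2 * z - 1 - a / q ^ 2) * B + a / q ^ 2 * C) * B);
      [ring|rewrite H3; ring]. }
  assert (0 < (q ^ 2 * z - 1 - a / q ^ 2) * (B * B)) by (apply Rmult_lt_0_compat; lra).
  pose proof (Rmult_lt_0_compat _ _ Hapos S2); lra.
Qed.

Lemma he_series_enumeration (q a : R) :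
  0 < q < 1 -> 0 < a < 1 ->
  exists s : nat -> R, enumerates_pos_zeros (he_series q a) s.
Proof.
  intros Hq Ha; apply isolated_zeros_enumeration;
    [|auto using he_series_unbounded_zeros].
  apply isolated_zeros_of_deriv with (he_series_deriv q a).
  - intros t; apply is_derive_he_series; lra.
  - intros t Ht Hdt; pose proof (he_wronskian_pos q a t Hq Ha) as HW.
    unfold he_wronskian in HW; rewrite Ht, Hdt in HW; lra.
Qed.

(** * Return to the Hahn-Exton functions *)

(** [HEJ] is a positive prefactor times F_a(x^2), because q^(2 nu + 2k + 2) = a q^(2k). *)
Lemma HEJ_zero_iff (q nu x : R) :
  0 < q < 1 -> 0 < x ->
  HEJ q nu x = 0 <-> he_series q (Rpower q (2 * nu + 2)) (x ^ 2) = 0.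
Proof.
  intros Hq Hx; pose proof (sqr_unit_interval q Hq) as Hp.
  assert (E : HEJ q nu x = Rpower x nu / qpoch_inf (q ^ 2) (q ^ 2)
              * he_series q (Rpower q (2 * nu + 2)) (x ^ 2)).
  { unfold HEJ, he_series, PSeries; f_equal; apply Series_ext; intros k.
    unfold he_coef; rewrite (pow_mult x).
    replace (Rpower q (2 * nu + 2 * INR k + 2))
      with (Rpower q (2 * nu + 2) * (q ^ 2) ^ k); [reflexivity|].
    rewrite <- pow_mult, <- Rpower_pow, <- Rpower_plus by lra.
    f_equal; rewrite mult_INR; simpl; ring. }
  assert (Hc : Rpower x nu / qpoch_inf (q ^ 2) (q ^ 2) <> 0).
  { apply Rgt_not_eq, Rdiv_lt_0_compat; [apply exp_pos|].
    apply qpoch_inf_pos; lra. }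
  rewrite E; split; intros H.
  - apply Rmult_integral in H as [H|H]; [contradiction|assumption].
  - rewrite H; ring.
Qed.

Theorem theorem3p7 (q nu : R) (hq0 : 0 < q) (hq1 : q < 1) (hnu : -1 < nu) :
  exists j0 j1 : nat -> R,
    enumerates_pos_zeros (HEJ q nu) j0 /\
    enumerates_pos_zeros (HEJ q (nu + 1)) j1 /\
    0 < j0 O /\
    (forall n : nat, j0 n < j1 n /\ j1 n < j0 (S n)).
Proof.
  assert (Hq : 0 < q < 1) by lra.
  pose proof (sqr_unit_interval q Hq) as Hp.
  set (a := Rpower q (2 * nu + 2)).
  (* Here nu > -1 enters: the exponent 2 nu + 2 is positive. *)
  assert (Ha : 0 < a < 1).
  { split; [apply exp_pos|].
    unfold a, Rpower; rewrite <- exp_0; apply exp_increasing.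
    pose proof (ln_increasing q 1 hq0 hq1) as Hln; rewrite ln_1 in Hln; nra. }
  assert (Hap : 0 < a * q ^ 2 < 1) by nra.
  assert (Ea : Rpower q (2 * (nu + 1) + 2) = a * q ^ 2).
  { unfold a; rewrite <- (Rpower_pow 2), <- Rpower_plus by lra.
    f_equal; simpl; ring. }
  destruct (he_series_enumeration q a Hq Ha) as [s Hs].
  destruct (he_series_enumeration q (a * q ^ 2) Hq Hap) as [t Ht].
  assert (Hf : forall z, is_derive (he_series q a) z (he_series_deriv q a z))
    by (intros z; apply is_derive_he_series; lra).
  assert (Hg : forall z, is_derive (he_series q (a * q ^ 2)) z
                           (he_series_deriv q (a * q ^ 2) z))
    by (intros z; apply is_derive_he_series; lra).
  pose proof (fun z => he_wronskian_pos q a z Hq Ha) as HW.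
  unfold he_wronskian in HW.
  assert (Hint : forall n, s n < t n /\ t n < s (S n)).
  { apply (enumerations_interlace _ _ _ _ Hs Ht).
    - exact (wronskian_zeros_between _ _ _ _ Hf Hg HW).
    - intros x y Hxy Hx Hy.
      (* Passing to (-g, f) keeps the Wronskian and exchanges the roles of the two functions. *)
      apply (wronskian_zeros_between (fun t => - he_series q (a * q ^ 2) t) _ _ _
        (is_derive_opp_pointwise _ _ Hg) Hf) with (x := x) (y := y);
        [intros z; specialize (HW z); lra|lra|lra|lra].
    - intros y; apply (wronskian_zero_below _ _ _ _ y Hf Hg HW);
        apply he_series_0_pos; lra. }
  assert (Hs' : enumerates_pos_zeros (HEJ q nu) (fun n => sqrt (s n))).
  { apply enumerates_pos_zeros_sqr with (2 := Hs).
    intros x Hx; apply HEJ_zero_iff; assumption. }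
  assert (Ht' : enumerates_pos_zeros (HEJ q (nu + 1)) (fun n => sqrt (t n))).
  { apply enumerates_pos_zeros_sqr with (2 := Ht).
    intros x Hx; rewrite <- Ea; apply HEJ_zero_iff; assumption. }
  exists (fun n => sqrt (s n)), (fun n => sqrt (t n)).
  split; [exact Hs'|split; [exact Ht'|split; [apply Hs'|]]].
  destruct Hs as [_ [_ Hspos]], Ht as [_ [_ Htpos]].
  intros n; specialize (Hint n).
  split; apply sqrt_lt_1_alt; split; try apply Rlt_le; try apply Hint; auto.
Qed.
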